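(* Suppose nature draws the true function $\bar g$ uniformly at random from $\mathcal{G}_{2k+1}$. Conditionally on $\bar g$, let $\bm{x}_1,\dots,\bm{x}_n$ be i.i.d. $\mathrm{Unif}[-1,1]^p$ and $\epsilon_1,\dots,\epsilon_n$ be i.i.d. $N(0,\sigma_\epsilon^2)$, independent of each other. Set $z_i=\bar g(\bm{x}_i)+\epsilon_i$ and $y_i=t(z_i)$, where $t:\mathbb{R}\to\mathcal{Y}$ is a fixed measurable function, and let $S'=\{(\bm{x}_i,y_i)\}_{i=1}^n$. Let $\hat g$ be any estimator, i.e. any (possibly randomized) function of $S'$ taking values in $\mathcal{G}_{2k+1}$. If $$n\le \Big(\log\Big(q^{k+1}\binom{p}{k+1}\Big)-2\log2\Big)\frac{\sigma_\epsilon^2}{2},$$ then $\mathbb{P}[\hat g\neq\bar g]\ge \tfrac12$.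
   Context: For $i=1,\dots,q$ let $\phi_i(z)=\sqrt2\cos(i\pi z)$ on $[-1,1]$. Let $p,q,k$ be positive integers with $k+1\le p$, and let $\mathcal{Y}\subseteq\mathbb{R}$. $\mathcal{G}_{2k+1}$ is the set of functions $g_\mathcal{A}(\bm{x})=\prod_{(i,j)\in\mathcal{A}}\phi_i(x_j)$ on $[-1,1]^p$, where $\mathcal{A}\subseteq\{1,\dots,q\}\times\{1,\dots,p\}$ satisfies: - $|\mathcal{A}|\le k+1$; - no two elements of $\mathcal{A}$ share the same second coordinate $j$. The empty product is the constant $1$. This is a restricted subclass of labeled binary trees that use only multiplication nodes and unit weights. *)

(* Defs.v *)
From HB Require Import structures.
From mathcomp Require Import all_boot all_order all_algebra.
From mathcomp Require Import all_classical all_reals all_analysis.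
Set Implicit Arguments. Unset Strict Implicit. Unset Printing Implicit Defensive.
Import Order.TTheory GRing.Theory Num.Theory.
Import numFieldNormedType.Exports.
Local Open Scope classical_set_scope.
Local Open Scope ring_scope.

Section Defs.
Variable R : realType.
Local Notation mu := (@lebesgue_measure R).

(* phi_{i+1}(z) = sqrt 2 * cos((i+1) pi z), for i : 'I_q (0-based index) *)
Definition phi (i : nat) (z : R) : R := Num.sqrt 2 * cos (i.+1%:R * pi * z).

Definition validA (q p k : nat) (A : {set 'I_q * 'I_p}) : bool :=
  (#|A| <= k.+1)%N &&
  [forall a in A, forall b in A, (a.2 == b.2) ==> (a == b)].

Definition gfun (q p : nat) (A : {set 'I_q * 'I_p}) (x : p.-tuple R) : R :=
  \prod_(a in A) phi a.1 (tnth x a.2).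

Fixpoint unifE (p : nat) : (p.-tuple R -> \bar R) -> \bar R :=
  match p with
  | 0 => fun F => F [tuple]
  | p'.+1 => fun F =>
      (\int[mu]_(u in `[(-1)%R, 1%R]) ((2^-1)%:E * unifE (fun v => F (cons_tuple u v))))%E
  end.

Fixpoint sampleE (p : nat) (g : p.-tuple R -> R) (t : R -> R) (sigma : R) (n : nat)
  : (n.-tuple (p.-tuple R * R) -> \bar R) -> \bar R :=
  match n with
  | 0 => fun F => F [tuple]
  | n'.+1 => fun F =>
      unifE (fun x => \int[mu]_e ((normal_pdf 0%R sigma (e : R))%:E *
         sampleE g t sigma (fun rest => F (cons_tuple (x, t (g x + (e : R))%R) rest))))%E
  end.

(* Probability that the estimator errs, P[ghat <> gbar], when the true index set
   Abar is uniform over the valid index sets and the (randomized) estimator outputs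
   the index set B with probability w S' B given the sample S'. *)
Definition err_prob (q p k : nat) (t : R -> R) (sigma : R) (n : nat)
  (w : n.-tuple (p.-tuple R * R) -> {set 'I_q * 'I_p} -> R) : \bar R :=
  ((#|[set A : {set 'I_q * 'I_p} | validA k A]|%:R)^-1%:E *
   \sum_(A : {set 'I_q * 'I_p} | validA k A)
      sampleE (gfun A) t sigma
        (fun s => (\sum_(B | validA k B)
                     w s B * (if `[< gfun B = gfun A >] then 0 else 1))%:E))%E.

End Defs.

(* Main.v *)
Require Import Defs.
From HB Require Import structures.
From mathcomp Require Import all_boot all_order all_algebra.
From mathcomp Require Import all_classical all_reals all_analysis.
From mathcomp Require Import measurable_realfun ring lra.
Set Implicit Arguments. Unset Strict Implicit. Unset Printing Implicit Defensive.
Import Order.TTheory GRing.Theory Num.Theory.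
Import numFieldNormedType.Exports.
Local Open Scope classical_set_scope.
Local Open Scope ring_scope.

(* A Fano-type bound, by comparison with the law of pure noise [z = e]. Let [N]
   be the number of valid index sets and let [rho_A] be the density of pure noise
   with respect to the law of the sample under [g_A], so that the mean of
   [- ln rho_A] under that law is [n E[g_A^2] / (2 sigma^2) = n / (2 sigma^2)].
   Since [1 + y <= exp y], for [0 <= w <= 1] and every [b],
     1 + w ln N <= b - ln rho_A + exp (- b) (1 + (N - 1) w) rho_A.
   Take [w := w s A] and [b := ln 2], integrate under the law of [g_A] (the factor
   [rho_A] turns it into the pure-noise law, which does not depend on [A]) and
   sum over [A]: as the [w s A] sum to 1, the average probability [c] of a correct
   decision satisfies [c ln N <= ln 2 + n / (2 sigma^2)]. Finally, evaluating on
   the coordinate axes shows that [A |-> g_A] is injective, and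
   [N >= q ^ k.+1 * 'C(p, k.+1)]. *)

(** * Laws of i.i.d. tuples and their iterated integrals *)

Section tuple_prob.
Context d (T : measurableType d) (R : realType).

Definition cons_pair n (z : T * n.-tuple T) : n.+1.-tuple T :=
  cons_tuple z.1 z.2.

Lemma measurable_cons_pair n : measurable_fun setT (@cons_pair n).
Proof. exact: (measurable_cons measurable_fst measurable_snd). Qed.

HB.instance Definition _ n :=
  isMeasurableFun.Build _ _ _ _ (@cons_pair n) (@measurable_cons_pair n).

Variable P : probability T R.

(** The [n]-fold product law, built head first: this is the order in which [unifE] and [sampleE]
    nest their integrals, so both can be matched to it by induction. *)
Fixpoint tuple_prob n : probability (n.-tuple T) R :=
  match n with
  | 0 => \d_([tuple] : 0.-tuple T)
  | n'.+1 => distribution (P \x tuple_prob n')%E (@cons_pair n')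
  end.

Local Open Scope ereal_scope.

Lemma measurable_integral_cons n (f : n.+1.-tuple T -> \bar R) :
  measurable_fun [set: n.+1.-tuple T] f -> (forall s, 0 <= f s) ->
  measurable_fun setT (fun x => \int[tuple_prob n]_s f (cons_tuple x s)).
Proof.
move=> mf f0.
apply: (@measurable_fun_fubini_tonelli_F _ _ _ _ _ (tuple_prob n)
  (f \o @cons_pair n)) => [|z]; last exact: f0.
exact: (measurableT_comp mf (@measurable_cons_pair n)).
Qed.

Lemma integral_tuple_prob0 (f : 0.-tuple T -> \bar R) :
  measurable_fun [set: 0.-tuple T] f -> \int[tuple_prob 0]_s f s = f [tuple].
Proof. by move=> mf; rewrite /= integral_dirac// diracT mul1e. Qed.

Lemma integral_tuple_probS n (f : n.+1.-tuple T -> \bar R) :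
  measurable_fun [set: n.+1.-tuple T] f -> (forall s, 0 <= f s) ->
  \int[tuple_prob n.+1]_s f s =
  \int[P]_x \int[tuple_prob n]_s f (cons_tuple x s).
Proof.
move=> mf f0 /=.
rewrite ge0_integral_pushforward//.
rewrite preimage_setT fubini_tonelli1//; last by move=> z; exact: f0.
exact: (measurableT_comp mf (@measurable_cons_pair n)).
Qed.

End tuple_prob.

(** * Integration against a measure given by a density *)

Section density.
Context d (T : measurableType d) (R : realType).
Import HBNNSimple.
Local Open Scope ereal_scope.

(** The hypothesis on [nu] is the case of indicators; linearity gives simple functions, and monotone
    convergence along [nnsfun_approx] gives the rest. *)
Lemma ge0_integral_density (m nu : {measure set T -> \bar R}) (h : T -> R)
    (f : T -> \bar R) :
  measurable_fun setT h -> (forall x, (0 <= h x)%R) ->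
  (forall A, measurable A -> nu A = \int[m]_(x in A) (h x)%:E) ->
  measurable_fun setT f -> (forall x, 0 <= f x) ->
  \int[nu]_x f x = \int[m]_x ((h x)%:E * f x).
Proof.
move=> mh h0 nuE mf f0.
have mhE : measurable_fun setT (fun x => (h x)%:E) by exact/measurable_EFinP.
have indicE E : measurable E ->
    \int[nu]_x (\1_E x)%:E = \int[m]_x ((h x)%:E * (\1_E x)%:E).
  move=> mE; rewrite integral_indic// setIT nuE// integral_mkcond.
  apply: eq_integral => x _; rewrite patchE indicE.
  by case: ifPn => xE; rewrite ?mule1 ?mule0.
have sfunE (g : {nnsfun T >-> R}) :
    \int[nu]_x (g x)%:E = \int[m]_x ((h x)%:E * (g x)%:E).
  under [LHS]eq_integral do rewrite fimfunE -fsumEFin//.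
  rewrite [LHS]ge0_integral_fsum//; last 2 first.
    - by move=> r; exact/measurable_EFinP/measurableT_comp.
    - by move=> n x _; rewrite EFinM nnfun_muleindic_ge0.
  under [RHS]eq_integral.
    move=> x xD; rewrite fimfunE -fsumEFin// ge0_mule_fsumr; last first.
      by move=> r; rewrite EFinM nnfun_muleindic_ge0.
    over.
  rewrite [RHS]ge0_integral_fsum//; last 2 first.
    - by move=> r; apply: emeasurable_funM => //;
        apply/measurable_EFinP; apply/measurableT_comp => //.
    - move=> n x _; rewrite EFinM mule_ge0//; first by rewrite lee_fin.
      by rewrite nnfun_muleindic_ge0.
  apply: eq_fsbigr => r rg.
  have r0 : (0 <= r)%R by move: rg; rewrite inE => -[x _ <-].
  under eq_integral do rewrite EFinM.
  rewrite ge0_integralZl_EFin//; last by exact/measurable_EFinP.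
  rewrite indicE//.
  under [RHS]eq_integral do rewrite EFinM muleCA.
  rewrite ge0_integralZl_EFin//.
    by move=> x _; rewrite mule_ge0// lee_fin.
  by apply: emeasurable_funM => //; exact/measurable_EFinP.
pose f_ := nnsfun_approx measurableT mf.
transitivity (lim (\int[nu]_x (f_ n x)%:E @[n --> \oo])).
  rewrite -monotone_convergence//=.
  - apply: eq_integral => ? /[!inE] xD; apply/esym/cvg_lim => //=.
    exact: cvg_nnsfun_approx.
  - by move=> n; exact/measurable_EFinP/measurable_funTS.
  - by move=> n ? _; rewrite lee_fin.
  - by move=> ? _ ? ? mn; rewrite lee_fin; exact/lefP/nd_nnsfun_approx.
under eq_fun do rewrite sfunE.
rewrite -monotone_convergence//=.
- apply: eq_integral => x _; apply/cvg_lim => //.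
  by apply: cvgeZl => //; exact: cvg_nnsfun_approx.
- by move=> n; apply: emeasurable_funM => //; exact/measurable_EFinP.
- by move=> n x _; rewrite mule_ge0// lee_fin.
- move=> x _ a b ab; apply: lee_pmul; rewrite ?lee_fin//.
  exact/lefP/nd_nnsfun_approx.
Qed.

End density.

(** * Gaussian densities, and translation and reflection of Lebesgue measure *)

Section real_line.
Context (R : realType).
Local Notation mu := (@lebesgue_measure R).
Local Open Scope ereal_scope.

Lemma ge0_integral_normal_prob (m s : R) (f : R -> \bar R) :
  measurable_fun setT f -> (forall x, 0 <= f x) ->
  \int[normal_prob m s]_x f x = \int[mu]_x ((normal_pdf m s x)%:E * f x).
Proof.
move=> mf f0; apply: ge0_integral_density => //.
- exact: measurable_normal_pdf.
- by move=> x; exact: normal_pdf_ge0.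
Qed.

(** The image of [mu] under the translation agrees with [mu] on the intervals []a, b]], which
    determine it. *)
Lemma ge0_integral_shift (c : R) (f : R -> \bar R) :
  measurable_fun setT f -> (forall x, 0 <= f x) ->
  \int[mu]_x f (x + c)%R = \int[mu]_x f x.
Proof.
move=> mf f0.
have mc : measurable_fun (setT : set (measurableTypeR R))
    (fun x => (x + c)%R : measurableTypeR R).
  exact: (@measurable_funD _ _ R setT id (cst c)).
pose g : {mfun measurableTypeR R >-> measurableTypeR R} :=
  HB.pack (fun x : measurableTypeR R => (x + c)%R : measurableTypeR R)
    (isMeasurableFun.Build _ _ _ _ _ mc).
transitivity (\int[pushforward mu g]_x f x).
  by rewrite ge0_integral_pushforward.
apply: eq_measure_integral => A mA _; apply/esym.
apply: lebesgue_measure_unique => //= _ [[a b] _ <-].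
rewrite /pushforward.
rewrite (_ : g @^-1` _ = `]a - c, b - c]%classic)%R; last first.
  by apply/seteqP; split => x /=; rewrite !in_itv/= ltrBlDr lerBrDr.
rewrite !lebesgue_measure_itv/= !lte_fin ltrD2r -!EFinB.
by congr (if _ then (_)%:E else _); ring.
Qed.

Lemma ge0_integral_opp (f : R -> \bar R) :
  measurable_fun setT f -> (forall x, 0 <= f x) ->
  \int[mu]_x f (- x)%R = \int[mu]_x f x.
Proof.
move=> mf f0.
transitivity (\int[pushforward mu (-%R : _ -> measurableTypeR R)]_x f x).
  by rewrite ge0_integral_pushforward.
by apply: eq_measure_integral => A mA _; exact: lebesgue_measureN.
Qed.

End real_line.

(** * Sums, products and changes of law for i.i.d. tuples *)

Section tuple_prob_theory.
Context d (T : measurableType d) (R : realType) (P : probability T R).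
Local Open Scope ereal_scope.

Lemma prodr_tnth_cons n (h : 'I_n.+1 -> T -> R) x (s : n.-tuple T) :
  (\prod_(i < n.+1) h i (tnth (cons_tuple x s) i) =
   h ord0 x * \prod_(i < n) h (lift ord0 i) (tnth s i))%R.
Proof.
by rewrite big_ord_recl tnth0; congr *%R; apply: eq_bigr => i _; rewrite tnthS.
Qed.

Lemma measurable_prodr_tnth n (h : 'I_n -> T -> R) :
  (forall i, measurable_fun setT (h i)) ->
  measurable_fun setT (fun s : n.-tuple T => \prod_(i < n) h i (tnth s i))%R.
Proof.
move=> mh; apply: measurable_prod => i _.
exact: (measurableT_comp (mh i) (measurable_tnth i)).
Qed.

Lemma measurable_sumr_tnth n (f : T -> R) : measurable_fun setT f ->
  measurable_fun setT (fun s : n.-tuple T => \sum_(i < n) f (tnth s i))%R.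
Proof.
move=> mf; apply: measurable_sum => i.
exact: (measurableT_comp mf (measurable_tnth i)).
Qed.

Lemma integral_tuple_prob_cst n (c : R) : \int[tuple_prob P n]_s c%:E = c%:E.
Proof.
rewrite integral_cst//.
by rewrite [X in _ * X]probability_setT mule1.
Qed.

Lemma integral_tuple_prob_sum n (f : T -> R) :
  measurable_fun setT f -> (forall x, 0 <= f x)%R ->
  \int[tuple_prob P n]_s (\sum_(i < n) f (tnth s i))%:E =
  n%:R%:E * \int[P]_x (f x)%:E.
Proof.
move=> mf f0; elim: n => [|n IHn].
  rewrite integral_tuple_prob0; last by apply/measurable_EFinP; apply: measurable_sumr_tnth.
  (* The integral of [f] may be infinite: the convention [0 * +oo = 0] settles this case. *)
  by rewrite big_ord0 mul0e.
rewrite integral_tuple_probS; last 2 first.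
- by apply/measurable_EFinP; apply: measurable_sumr_tnth.
- by move=> s; rewrite lee_fin sumr_ge0.
transitivity (\int[P]_x ((f x)%:E + n%:R%:E * \int[P]_x (f x)%:E)).
  apply: eq_integral => x _; rewrite -IHn.
  rewrite -[X in X + _](integral_tuple_prob_cst n) -ge0_integralD//; last 3 first.
  - by move=> s _; rewrite lee_fin.
  - by move=> s _; rewrite lee_fin sumr_ge0.
  - by apply/measurable_EFinP; apply: measurable_sumr_tnth.
  apply: eq_integral => s _; rewrite big_ord_recl tnth0 EFinD.
  by under eq_bigr do rewrite tnthS.
have I0 : 0 <= \int[P]_x (f x)%:E by apply: integral_ge0 => x _; rewrite lee_fin.
have E0 : 0 <= n%:R%:E * \int[P]_x (f x)%:E by rewrite mule_ge0// lee_fin.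
rewrite ge0_integralD//; last 2 first.
- by move=> x _; rewrite lee_fin.
- exact/measurable_EFinP.
rewrite (_ : \int[P]_x (n%:R%:E * _) = n%:R%:E * \int[P]_x (f x)%:E); last first.
  by rewrite integral_cst// [X in _ * X]probability_setT mule1.
by rewrite -natr1 EFinD ge0_muleDl ?lee_fin// mul1e addeC.
Qed.

(** Independence: the head factor comes out of the integral over the tail. This serves to normalise
    the squares of the features, which factor over the coordinates. *)
Lemma integral_tuple_prob_prod1 n (h : 'I_n -> T -> R) :
  (forall i, measurable_fun setT (h i)) -> (forall i x, 0 <= h i x)%R ->
  (forall i, \int[P]_x (h i x)%:E = 1) ->
  \int[tuple_prob P n]_s (\prod_(i < n) h i (tnth s i))%:E = 1.
Proof.
elim: n h => [|n IHn] h mh h0 h1.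
  rewrite integral_tuple_prob0; last by apply/measurable_EFinP; apply: measurable_prodr_tnth.
  by rewrite big_ord0.
rewrite integral_tuple_probS; last 2 first.
- by apply/measurable_EFinP; apply: measurable_prodr_tnth.
- by move=> s; rewrite lee_fin prodr_ge0.
rewrite -[RHS](h1 ord0); apply: eq_integral => x _.
under eq_integral do rewrite prodr_tnth_cons EFinM.
rewrite ge0_integralZl_EFin//.
- by rewrite (IHn (fun i => h (lift ord0 i)))// mule1.
- by move=> s _; rewrite lee_fin prodr_ge0.
- by apply/measurable_EFinP; apply: (@measurable_prodr_tnth _ (fun i => h (lift ord0 i))).
Qed.

Context d' (S : measurableType d').

Lemma measurable_map_tuple n (H : T -> S) : measurable_fun setT H ->
  measurable_fun setT (fun s : n.-tuple T => map_tuple H s).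
Proof.
move=> mH; apply/measurable_fun_tnthP => i.
rewrite (_ : _ \o _ = H \o (@tnth n T ^~ i)); last first.
  by apply/funext => s /=; rewrite tnth_map.
exact: (measurableT_comp mH (measurable_tnth i)).
Qed.

Lemma map_cons_tuple n (H : T -> S) x (s : n.-tuple T) :
  map_tuple H (cons_tuple x s) = cons_tuple (H x) (map_tuple H s).
Proof. exact/val_inj. Qed.

(** Lifts a change of law from one observation to [n] of them, the density being the product of the
    [rho]. The weight [rho] is a function of the latent point [x] and not of the observation [H x],
    so [H] may lose information. *)
Lemma integral_tuple_prob_likelihood (H H0 : T -> S) (rho : T -> R) :
  measurable_fun setT H -> measurable_fun setT H0 ->
  measurable_fun setT rho -> (forall x, 0 <= rho x)%R ->
  (forall G : S -> \bar R, measurable_fun setT G -> (forall y, 0 <= G y) ->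
    \int[P]_x ((rho x)%:E * G (H x)) = \int[P]_x G (H0 x)) ->
  forall n (F : n.-tuple S -> \bar R),
  measurable_fun [set: n.-tuple S] F -> (forall s, 0 <= F s) ->
  \int[tuple_prob P n]_s
    ((\prod_(i < n) rho (tnth s i))%:E * F (map_tuple H s)) =
  \int[tuple_prob P n]_s F (map_tuple H0 s).
Proof.
move=> mH mH0 mrho rho0 rhoE.
have mF0 n (F : n.-tuple S -> \bar R) : measurable_fun [set: n.-tuple S] F ->
    measurable_fun setT (fun s : n.-tuple T => F (map_tuple H0 s)).
  by move=> mF; exact: (measurableT_comp mF (measurable_map_tuple mH0)).
have mFrho n (F : n.-tuple S -> \bar R) : measurable_fun [set: n.-tuple S] F ->
    measurable_fun setT (fun s : n.-tuple T =>
      (\prod_(i < n) rho (tnth s i))%:E * F (map_tuple H s)).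
  move=> mF; apply: emeasurable_funM.
    by apply/measurable_EFinP; exact: (@measurable_prodr_tnth _ (fun=> rho)).
  exact: (measurableT_comp mF (measurable_map_tuple mH)).
have F0rho n (F : n.-tuple S -> \bar R) (s : n.-tuple T) : (forall s, 0 <= F s) ->
    0 <= (\prod_(i < n) rho (tnth s i))%:E * F (map_tuple H s).
  by move=> F0; rewrite mule_ge0// lee_fin prodr_ge0.
elim=> [|n IHn] F mF F0.
  rewrite integral_tuple_prob0; last exact: mFrho.
  rewrite integral_tuple_prob0; last exact: mF0.
  by rewrite big_ord0 mul1e; congr F; exact/val_inj.
rewrite integral_tuple_probS; last 2 first.
- exact: mFrho.
- by move=> s; exact: F0rho.
rewrite integral_tuple_probS; last 2 first.
- exact: mF0.
- by move=> s; exact: F0.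
(* [G] integrates out the tail, already observed through [H0]: the induction hypothesis changes the
   law of the tail at a fixed head, then [rhoE] applied to [G] changes that of the head. *)
pose G y := \int[tuple_prob P n]_s F (cons_tuple y (map_tuple H0 s)).
have mFc (K : T -> S) y : measurable_fun setT K ->
    measurable_fun setT (fun s : n.-tuple T => F (cons_tuple y (map_tuple K s))).
  move=> mK; apply: (measurableT_comp mF).
  apply: (@measurable_cons _ _ (n.-tuple T) S (fun=> y) n (map_tuple K)) => //.
  exact: measurable_map_tuple.
have mFy y : measurable_fun [set: n.-tuple S] (fun s => F (cons_tuple y s)).
  apply: (measurableT_comp mF).
  by apply: (@measurable_cons _ _ (n.-tuple S) S (fun=> y) n id).
transitivity (\int[P]_x ((rho x)%:E * G (H x))).
  apply: eq_integral => x _; rewrite /G.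
  rewrite -(IHn (fun s => F (cons_tuple (H x) s)))//.
  rewrite -ge0_integralZl_EFin//; last 2 first.
  - by move=> s _; rewrite mule_ge0// lee_fin prodr_ge0.
  - apply: emeasurable_funM; last exact: mFc.
    by apply/measurable_EFinP; exact: (@measurable_prodr_tnth _ (fun=> rho)).
  apply: eq_integral => s _.
  by rewrite (prodr_tnth_cons (fun=> rho)) map_cons_tuple EFinM muleA.
rewrite rhoE.
- by apply: eq_integral => x _; apply: eq_integral => s _; rewrite map_cons_tuple.
- apply: (@measurable_fun_fubini_tonelli_F _ _ S (n.-tuple T) R (tuple_prob P n)
    (fun z => F (cons_tuple z.1 (map_tuple H0 z.2)))) => [|z]; last exact: F0.
  apply: (measurableT_comp mF); apply: measurable_cons => //.
  exact: (measurableT_comp (measurable_map_tuple mH0) measurable_snd).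
- by move=> y; apply: integral_ge0 => s _; exact: F0.
Qed.

End tuple_prob_theory.

(** * The expectations [unifE] and [sampleE] as integrals against probabilities *)

Section real_probabilities.
Variable R : realType.
Local Notation mu := (@lebesgue_measure R).

(* [uniform_prob] and [normal_prob] live on [measurableTypeR R], whose display
   differs from that of the measurable type [R]. *)
Definition of_measurableTypeR (x : measurableTypeR R) : R := x.

Lemma measurable_of_measurableTypeR : measurable_fun setT of_measurableTypeR.
Proof. by move=> _ A mA; rewrite setTI. Qed.

HB.instance Definition _ := isMeasurableFun.Build _ _ _ _
  of_measurableTypeR measurable_of_measurableTypeR.

Fact ltrN11 : -1 < 1 :> R. Proof. by rewrite (lt_trans (ltrN10 R)). Qed.

Definition uniformN11 : probability R R :=
  distribution (uniform_prob ltrN11) of_measurableTypeR.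

Definition gauss (sigma : R) : probability R R :=
  distribution (normal_prob 0 sigma) of_measurableTypeR.

Local Open Scope ereal_scope.

Lemma integral_uniformN11 (f : R -> \bar R) :
  measurable_fun setT f -> (forall x, 0 <= f x) ->
  \int[uniformN11]_x f x = (2^-1)%:E * \int[mu]_(x in `[(-1)%R, 1%R]) f x.
Proof.
move=> mf f0; rewrite ge0_integral_pushforward// preimage_setT/=.
rewrite integral_uniform//; congr (_%:E * _); congr (_^-1)%R; lra.
Qed.

Lemma integral_gauss sigma (f : R -> \bar R) :
  measurable_fun setT f -> (forall x, 0 <= f x) ->
  \int[gauss sigma]_x f x = \int[mu]_x ((normal_pdf 0 sigma x)%:E * f x).
Proof.
move=> mf f0; rewrite ge0_integral_pushforward// preimage_setT/=.
exact: ge0_integral_normal_prob.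
Qed.

(** The factor [2^-1] inside each integral of [unifE] is the density of [uniformN11]; it is pulled
    out by linearity. *)
Lemma unifE_integral p (F : p.-tuple R -> \bar R) :
  measurable_fun [set: p.-tuple R] F -> (forall x, 0 <= F x) ->
  unifE F = \int[tuple_prob uniformN11 p]_x F x.
Proof.
elim: p F => [|p IHp] F mF F0; first by rewrite integral_tuple_prob0.
rewrite integral_tuple_probS// integral_uniformN11; last 2 first.
- exact: measurable_integral_cons.
- by move=> x; exact: integral_ge0.
rewrite /= -ge0_integralZl//; last 2 first.
- by apply: measurable_funTS; exact: (measurable_integral_cons uniformN11 mF F0).
- by move=> x _; exact: integral_ge0.
apply: eq_integral => u _; rewrite IHp//.
apply: (measurableT_comp mF).
by apply: (@measurable_cons _ _ (p.-tuple R) R (fun=> u) p id).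
Qed.

Variables (p : nat) (sigma : R).

(** The law of the latent pair of a design point and its noise. It is the same for every true
    function, which enters only through [observe]. *)
Definition noisy_prob : probability (p.-tuple R * R)%type R :=
  tuple_prob uniformN11 p \x gauss sigma.

Lemma integral_noisy_prob (F : p.-tuple R * R -> \bar R) :
  measurable_fun [set: p.-tuple R * R] F -> (forall z, 0 <= F z) ->
  \int[noisy_prob]_z F z =
  \int[tuple_prob uniformN11 p]_x \int[gauss sigma]_e F (x, e).
Proof. by move=> mF F0; rewrite /noisy_prob fubini_tonelli1. Qed.

Variables (g : p.-tuple R -> R) (t : R -> R).
Hypotheses (mg : measurable_fun [set: p.-tuple R] g) (mt : measurable_fun setT t).

Definition observe (z : p.-tuple R * R) : p.-tuple R * R :=
  (z.1, t (g z.1 + z.2)%R).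

Lemma measurable_observe : measurable_fun setT observe.
Proof.
apply: measurable_fun_pair => //.
apply: (measurableT_comp mt); apply: measurable_funD => //.
exact: (measurableT_comp mg measurable_fst).
Qed.

(** Puts the samples drawn under different [g] on one probability space of latent pairs, where their
    laws can be compared. *)
Lemma sampleE_integral n (F : n.-tuple (p.-tuple R * R) -> \bar R) :
  measurable_fun [set: n.-tuple (p.-tuple R * R)] F -> (forall s, 0 <= F s) ->
  sampleE g t sigma F =
  \int[tuple_prob noisy_prob n]_s F (map_tuple observe s).
Proof.
have mo := measurable_observe.
elim: n F => [|n IHn] F mF F0.
  rewrite integral_tuple_prob0/=; first by congr F; exact/val_inj.
  exact: (measurableT_comp mF (measurable_map_tuple mo)).
have mFc y : measurable_fun [set: n.-tuple _] (fun s => F (cons_tuple y s)).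
  apply: (measurableT_comp mF).
  by apply: (@measurable_cons _ _ (n.-tuple _) _ (fun=> y) n id).
have mFo := measurableT_comp mF (measurable_map_tuple mo).
rewrite integral_tuple_probS//.
(* [K] averages over all latent pairs but the first. Its joint measurability in the design point and
   the noise is what Tonelli requires. *)
pose K z := \int[tuple_prob noisy_prob n]_s
  F (map_tuple observe (cons_tuple z s)).
have mK : measurable_fun setT K.
  exact: (measurable_integral_cons noisy_prob mFo (fun s => F0 _)).
have K0 z : 0 <= K z by apply: integral_ge0 => s _; exact: F0.
rewrite -/K integral_noisy_prob//=.
rewrite (_ : (fun x => _) = (fun x => \int[gauss sigma]_e K (x, e))).
  rewrite unifE_integral//.
  - exact: (measurable_fun_fubini_tonelli_F _ mK).
  - by move=> x; apply: integral_ge0.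
apply/funext => x; rewrite integral_gauss//; last first.
  exact: (measurableT_comp mK (measurable_pair1 x)).
apply: eq_integral => e _; congr (_ * _).
rewrite IHn//; apply: eq_integral => s _.
by rewrite map_cons_tuple.
Qed.

End real_probabilities.

(** * Likelihood ratios of shifted Gaussian noise *)

Section gaussian_noise.
Variables (R : realType) (sigma : R).
Hypothesis sigma_gt0 : 0 < sigma.
Local Notation mu := (@lebesgue_measure R).

Let sigma_neq0 : sigma != 0. Proof. exact: lt0r_neq0. Qed.

(** The log-likelihood ratio of the signal [c] against pure noise at the value [c + e], written in
    terms of the noise [e]. *)
Definition loglik (c e : R) : R := (c * e + c ^+ 2 / 2) / sigma ^+ 2.

Lemma normal_pdf_shift (c e : R) :
  normal_pdf 0 sigma (e + c) = normal_pdf 0 sigma e * expR (- loglik c e).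
Proof.
rewrite !normal_pdfE// -mulrA /normal_fun -expRD; congr (_ * expR _).
by rewrite /loglik; field.
Qed.

Lemma normal_pdf_opp (e : R) : normal_pdf 0 sigma (- e) = normal_pdf 0 sigma e.
Proof. by rewrite !normal_pdfE// /normal_fun !subr0 sqrrN. Qed.

Local Open Scope ereal_scope.

Lemma measurable_expR_loglik c : measurable_fun setT (fun e => expR (- loglik c e)).
Proof.
apply: measurableT_comp => //; apply: measurableT_comp => //.
apply: measurable_funM => //; apply: measurable_funD => //.
Qed.

(** The weight turns the Gaussian density at [e] into the density at [e + c]; translation invariance
    of [mu] does the rest. *)
Lemma integral_gauss_shift c (f : R -> \bar R) :
  measurable_fun setT f -> (forall x, 0 <= f x) ->
  \int[gauss sigma]_e ((expR (- loglik c e))%:E * f (c + e)%R) =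
  \int[gauss sigma]_e f e.
Proof.
move=> mf f0.
have mfc : measurable_fun setT (fun e : R => f (c + e)%R).
  by apply: (measurableT_comp mf); exact: measurable_funD.
rewrite !integral_gauss//; last 2 first.
- apply: emeasurable_funM => //; apply/measurable_EFinP; exact: measurable_expR_loglik.
- by move=> e; rewrite mule_ge0// lee_fin expR_ge0.
rewrite -[RHS](ge0_integral_shift c); last 2 first.
- apply: emeasurable_funM => //; apply/measurable_EFinP; exact: measurable_normal_pdf.
- by move=> e; rewrite mule_ge0// lee_fin normal_pdf_ge0.
by apply: eq_integral => e _; rewrite normal_pdf_shift EFinM muleA (addrC e).
Qed.

Lemma integral_gauss_opp (f : R -> \bar R) :
  measurable_fun setT f -> (forall x, 0 <= f x) ->
  \int[gauss sigma]_e f (- e)%R = \int[gauss sigma]_e f e.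
Proof.
move=> mf f0.
have mfN : measurable_fun setT (fun e : R => f (- e)%R).
  exact: (measurableT_comp mf).
rewrite !integral_gauss// -[RHS]ge0_integral_opp; last 2 first.
- apply: emeasurable_funM => //; apply/measurable_EFinP; exact: measurable_normal_pdf.
- by move=> e; rewrite mule_ge0// lee_fin normal_pdf_ge0.
by apply: eq_integral => e _; rewrite normal_pdf_opp.
Qed.

(** Since [1 + e <= expR e] and [1 - e <= expR (- e)], the sum of these two exponentials dominates
    [|e|], and both have a finite mean. *)
Lemma integral_gauss_norm_lty : \int[gauss sigma]_e `|e|%:E < +oo.
Proof.
pose C := expR (sigma ^+ 2 / 2).
(* As [loglik (sigma ^+ 2) e = e + sigma ^+ 2 / 2], shifting the constant function [C] by
   [sigma ^+ 2] computes this mean. *)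
have expE : \int[gauss sigma]_e (expR (- e))%:E = C%:E.
  have := @integral_gauss_shift (sigma ^+ 2) (fun=> C%:E).
  rewrite integral_cst// [X in _ * X]probability_setT mule1 => <- //; last first.
    by move=> _; rewrite lee_fin expR_ge0.
  apply: eq_integral => e _; rewrite -EFinM -expRD; congr (expR _)%:E.
  by rewrite /loglik; field.
have mexp : measurable_fun setT (fun e : R => (expR (- e))%:E).
  by apply/measurable_EFinP; exact: measurableT_comp.
apply: (@le_lt_trans _ _ (\int[gauss sigma]_e ((expR (- e))%:E + (expR (- - e))%:E))).
  apply: ge0_le_integral => //.
  - by apply/measurable_EFinP; exact: normr_measurable.
  - apply: emeasurable_funD => //.
    exact: (measurableT_comp mexp (@oppr_measurable R setT)).
  - move=> e _; rewrite -EFinD lee_fin opprK ler_norml.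
    have := expR_ge1Dx e; have := expR_ge1Dx (- e).
    have := expR_ge0 e; have := expR_ge0 (- e); lra.
rewrite ge0_integralD//.
- rewrite (integral_gauss_opp mexp); last by move=> e; rewrite lee_fin expR_ge0.
  by rewrite expE -EFinD ltry.
- exact: (measurableT_comp mexp (@oppr_measurable R setT)).
Qed.

End gaussian_noise.

(** * The bound on the probability of a correct decision under one function [g] *)

Section correct_decision_bound.
Variables (R : realType) (sigma : R) (p : nat) (g : p.-tuple R -> R) (t : R -> R).
Hypotheses (sigma_gt0 : 0 < sigma) (mg : measurable_fun [set: p.-tuple R] g).
Hypothesis mt : measurable_fun setT t.
Local Open Scope ereal_scope.
Hypothesis g_norm1 : \int[tuple_prob (uniformN11 R) p]_x (g x ^+ 2)%:E = 1.

Let T := (p.-tuple R * R)%type.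
Let mg1 : measurable_fun setT (fun z : T => g z.1).
Proof. exact: (measurableT_comp mg measurable_fst). Qed.
Let mge : measurable_fun setT (fun z : T => g z.1 * z.2)%R.
Proof. exact: measurable_funM. Qed.
Let sigma2_gt0 : (0 < sigma ^+ 2)%R. Proof. exact: exprn_gt0. Qed.

(* The log-likelihood [u + k - v] is split into nonnegative terms, so that only
   integrals of nonnegative functions are needed. *)
Let u (z : T) : R := (Num.max (g z.1 * z.2) 0 / sigma ^+ 2)%R.
Let v (z : T) : R := (Num.max (- (g z.1 * z.2)) 0 / sigma ^+ 2)%R.
Let k (z : T) : R := (g z.1 ^+ 2 / (2 * sigma ^+ 2))%R.

Let mu_ : measurable_fun setT u.
Proof. by apply: measurable_funM => //; exact: measurable_maxr. Qed.
Let mv : measurable_fun setT v.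
Proof.
apply: measurable_funM => //; apply: measurable_maxr => //.
exact: (measurableT_comp (@oppr_measurable R setT) mge).
Qed.
Let mk : measurable_fun setT k.
Proof. by apply: measurable_funM => //; exact: measurable_funX. Qed.

Let u0 z : (0 <= u z)%R.
Proof. by rewrite /u divr_ge0 ?(ltW sigma2_gt0)// le_max lexx orbT. Qed.
Let v0 z : (0 <= v z)%R.
Proof. by rewrite /v divr_ge0 ?(ltW sigma2_gt0)// le_max lexx orbT. Qed.
Let k0 z : (0 <= k z)%R.
Proof. by rewrite /k divr_ge0 ?sqr_ge0// mulr_ge0 ?(ltW sigma2_gt0). Qed.

Let loglikE z : loglik sigma (g z.1) z.2 = (u z + k z - v z)%R.
Proof.
rewrite /loglik /u /v /k.
have E : (g z.1 * z.2 = Num.max (g z.1 * z.2) 0 - Num.max (- (g z.1 * z.2)) 0)%R.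
  by case: (leP (g z.1 * z.2)%R 0%R); case: (leP (- (g z.1 * z.2))%R 0%R); lra.
by rewrite {1}E; field; rewrite lt0r_neq0.
Qed.

Let mE (h : T -> R) : measurable_fun setT h -> measurable_fun setT (EFin \o h).
Proof. by move=> mh; exact/measurable_EFinP. Qed.

(** The noise is symmetric, and changing the sign of [e] exchanges [u] and [v]. *)
Let integral_u : \int[noisy_prob p sigma]_z (u z)%:E = \int[noisy_prob p sigma]_z (v z)%:E.
Proof.
rewrite integral_noisy_prob; last 2 first.
- exact: (mE mu_).
- by move=> z; rewrite lee_fin.
rewrite integral_noisy_prob; last 2 first.
- exact: (mE mv).
- by move=> z; rewrite lee_fin.
apply: eq_integral => x _.
rewrite -(integral_gauss_opp sigma_gt0 (f := fun e => (u (x, e))%:E)).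
- by apply: eq_integral => e _; rewrite /u /v/= mulrN.
- exact: (measurableT_comp (mE mu_) (measurable_pair1 x)).
- by move=> e; rewrite lee_fin.
Qed.

(** This is the only place where the log-likelihood ratio has a nonzero mean, the means of [u] and
    [v] cancelling: it is the divergence contributed by one observation. *)
Let integral_k : \int[noisy_prob p sigma]_z (k z)%:E = ((2 * sigma ^+ 2)^-1)%:E.
Proof.
rewrite integral_noisy_prob; last 2 first.
- exact: (mE mk).
- by move=> z; rewrite lee_fin.
under eq_integral.
  move=> x _; rewrite /k/= integral_cst// [X in _ * X]probability_setT mule1.
  rewrite mulrC EFinM; over.
rewrite ge0_integralZl_EFin//.
- by rewrite g_norm1 mule1.
- by move=> x _; rewrite lee_fin sqr_ge0.
- by apply/measurable_EFinP; exact: measurable_funX.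
- by rewrite invr_ge0 mulr_ge0// ltW.
Qed.

(** Finiteness is what allows the means of [u] and [v] to cancel. It follows from
    [|g e| <= (1 + g^2) |e|], whose right side has independent factors of finite mean. *)
Let integral_v_fin : \int[noisy_prob p sigma]_z (v z)%:E \is a fin_num.
Proof.
rewrite ge0_fin_numE; last by apply: integral_ge0 => z _; rewrite lee_fin.
have : \int[gauss sigma]_e `|e|%:E \is a fin_num.
  rewrite ge0_fin_numE ?integral_gauss_norm_lty//.
  by apply: integral_ge0 => z _; rewrite lee_fin.
move=> /fineK; set c := fine _ => cE.
have msq : measurable_fun setT (fun x => ((1 + g x ^+ 2) / sigma ^+ 2)%R).
  apply: measurable_funM => //; apply: measurable_funD => //.
  exact: measurable_funX.
have sq0 x : (0 <= (1 + g x ^+ 2) / sigma ^+ 2)%R.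
  by rewrite divr_ge0 ?(ltW sigma2_gt0)// addr_ge0// sqr_ge0.
pose h (z : T) := ((1 + g z.1 ^+ 2) / sigma ^+ 2 * `|z.2|)%R.
have mh : measurable_fun setT h.
  apply: measurable_funM; first exact: (measurableT_comp msq measurable_fst).
  exact: (measurableT_comp (@normr_measurable R setT) measurable_snd).
apply: (@le_lt_trans _ _ (\int[noisy_prob p sigma]_z (h z)%:E)).
  apply: ge0_le_integral => //.
  - by move=> z _; rewrite lee_fin.
  - exact: (mE mv).
  - exact: (mE mh).
  move=> z _; rewrite lee_fin /v /h mulrAC ler_wpM2r// ?invr_ge0 ?(ltW sigma2_gt0)//.
  rewrite ge_max mulr_ge0 ?addr_ge0 ?sqr_ge0// andbT.
  apply: (le_trans (ler_norm _)); rewrite normrN normrM ler_wpM2r//.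
  have := sqr_ge0 (`|g z.1| - 1)%R; rewrite -(real_normK (num_real (g z.1))).
  have := normr_ge0 (g z.1); nra.
rewrite integral_noisy_prob; last 2 first.
- exact: (mE mh).
- by move=> z; rewrite lee_fin mulr_ge0.
under eq_integral.
  move=> x _; rewrite /h/=; under eq_integral do rewrite EFinM.
  rewrite ge0_integralZl_EFin//; last first.
    by apply/measurable_EFinP; exact: normr_measurable.
  rewrite -cE muleC.
  over.
rewrite ge0_integralZl_EFin//; last 3 first.
- by move=> e _; rewrite lee_fin.
- exact/measurable_EFinP.
- by rewrite -lee_fin cE; apply: integral_ge0 => e _; rewrite lee_fin.
under eq_integral do rewrite mulrC EFinM.
rewrite ge0_integralZl_EFin//; last 3 first.
- by move=> e _; rewrite lee_fin addr_ge0// sqr_ge0.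
- by apply/measurable_EFinP; apply: measurable_funD => //; exact: measurable_funX.
- by rewrite invr_ge0 ltW.
under eq_integral do rewrite EFinD.
rewrite ge0_integralD//; last 2 first.
- by move=> e _; rewrite lee_fin sqr_ge0.
- by apply/measurable_EFinP; exact: measurable_funX.
rewrite g_norm1 integral_cst// [X in _ * X + _]probability_setT mule1.
by rewrite -EFinD -!EFinM ltry.
Qed.

(** The factor of [rho_A] for one observation, taken on the latent pair. *)
Let rho (z : T) : R := expR (- loglik sigma (g z.1) z.2).

Let mrho : measurable_fun setT rho.
Proof.
apply: (measurableT_comp (@measurable_expR R)).
apply: (measurableT_comp (@oppr_measurable R setT)).
under eq_fun do rewrite loglikE.
by apply: measurable_funB => //; exact: measurable_funD.
Qed.

(** At a fixed design point [x] this is the Gaussian shift by [g x]. It takes place before [t] is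
    applied, so [t] is simply absorbed in the test function. *)
Let rhoE (G : T -> \bar R) : measurable_fun setT G -> (forall y, 0 <= G y) ->
  \int[noisy_prob p sigma]_z ((rho z)%:E * G (observe g t z)) =
  \int[noisy_prob p sigma]_z G (observe (fun=> 0%R) t z).
Proof.
move=> mG G0.
rewrite !integral_noisy_prob; last 4 first.
- exact: (measurableT_comp mG (measurable_observe (measurable_cst _) mt)).
- by move=> z; exact: G0.
- apply: emeasurable_funM; first exact: (mE mrho).
  exact: (measurableT_comp mG (measurable_observe mg mt)).
- by move=> z; rewrite mule_ge0// lee_fin expR_ge0.
apply: eq_integral => x _; rewrite /rho /observe/=.
rewrite (integral_gauss_shift sigma_gt0 (g x) (f := fun e => G (x, t e)))//.
  by apply: eq_integral => e _; rewrite add0r.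
apply: (measurableT_comp mG); exact: (measurableT_comp (measurable_pair1 x) mt).
Qed.

Variable n : nat.
Local Notation Pn := (tuple_prob (noisy_prob p sigma) n).

(** The pointwise inequality of the overview, integrated, with [lam] in place of [ln N]. Here [c]
    and [q] are the mean weights given to one index set under [g] and under pure noise. *)
Lemma correct_decision_bound (w : n.-tuple T -> R) (lam b c q : R) :
  measurable_fun [set: n.-tuple T] w -> (forall s, 0 <= w s <= 1)%R ->
  (0 <= lam)%R -> (0 <= b)%R ->
  \int[Pn]_s (w (map_tuple (observe g t) s))%:E = c%:E ->
  \int[Pn]_s (w (map_tuple (observe (fun=> 0%R) t) s))%:E = q%:E ->
  (1 + lam * c <=
   b + n%:R / (2 * sigma ^+ 2) + expR (- b) * (1 + (expR lam - 1) * q))%R.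
Proof.
move=> mw w01 lam0 b0 cE qE.
have w0 s : (0 <= w s)%R by case/andP: (w01 s).
have w1 s : (w s <= 1)%R by case/andP: (w01 s).
have elam : (0 <= expR lam - 1)%R by have := expR_ge1Dx lam; lra.
have mo := measurable_observe mg mt.
have mo0 : measurable_fun setT (@observe R p (fun=> 0%R) t).
  apply: measurable_observe => //; exact: measurable_cst.
pose wg s := w (map_tuple (observe g t) s).
have mwg : measurable_fun [set: n.-tuple T] wg.
  exact: (measurableT_comp mw (measurable_map_tuple mo)).
(* The factor that multiplies [rho_A] in the pointwise inequality; its mean under pure noise is
   explicit in [q]. *)
pose F s := (expR (- b) * (1 + (expR lam - 1) * w s))%R.
have F0 s : (0 <= F s)%R by rewrite mulr_ge0 ?expR_ge0// addr_ge0// mulr_ge0.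
have mF : measurable_fun [set: n.-tuple T] F.
  by apply: measurable_funM => //; apply: measurable_funD => //; exact: measurable_funM.
have aff (Q : probability (n.-tuple T) R) (f : n.-tuple T -> R) (a l m : R) :
    measurable_fun setT f -> (forall s, 0 <= f s)%R -> (0 <= a)%R -> (0 <= l)%R ->
    \int[Q]_s (f s)%:E = m%:E -> \int[Q]_s (a + l * f s)%:E = (a + l * m)%:E.
  move=> mf f0 a0 l0 fE; under eq_integral do rewrite EFinD EFinM.
  rewrite ge0_integralD//.
  - rewrite integral_cst// [X in _ * X + _]probability_setT mule1.
    by rewrite ge0_integralZl_EFin// ?fE// => [s _|]; rewrite ?lee_fin//;
      exact/measurable_EFinP.
  - by move=> s _; rewrite -EFinM lee_fin mulr_ge0.
  - by apply/measurable_EFinP; exact: measurable_funM.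
have FE : \int[Pn]_s (F (map_tuple (observe (fun=> 0%R) t) s))%:E =
    (expR (- b) * (1 + (expR lam - 1) * q))%:E.
  rewrite /F; under eq_integral do rewrite EFinM.
  have mw0 := measurableT_comp mw (measurable_map_tuple (n := n) mo0).
  rewrite ge0_integralZl_EFin ?expR_ge0//.
  - by rewrite EFinM; congr (_ * _); apply: (aff _ _ _ _ _ mw0) => // s; exact: w0.
  - by move=> s _; rewrite lee_fin addr_ge0// mulr_ge0.
  - by apply/measurable_EFinP; apply: measurable_funD => //; exact: measurable_funM.
have rho0 z : (0 <= rho z)%R by exact: expR_ge0.
have mFE : measurable_fun [set: n.-tuple T] (fun s => (F s)%:E).
  exact/measurable_EFinP.
have F0E s : 0 <= (F s)%:E by rewrite lee_fin.
have := integral_tuple_prob_likelihood mo mo0 mrho rho0 rhoE mFE F0E.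
rewrite {}FE => rhoFE.
pose V := fine (\int[noisy_prob p sigma]_z (v z)%:E).
have VE : \int[noisy_prob p sigma]_z (v z)%:E = V%:E by rewrite fineK.
pose uk z := (u z + k z)%R.
have muk : measurable_fun setT uk by exact: measurable_funD.
have uk0 z : (0 <= uk z)%R by exact: addr_ge0.
have ukE : \int[noisy_prob p sigma]_z (uk z)%:E = (V + (2 * sigma ^+ 2)^-1)%:E.
  rewrite /uk; under eq_integral do rewrite EFinD.
  rewrite ge0_integralD//; last 4 first.
  - by move=> z _; rewrite lee_fin.
  - exact: (mE mu_).
  - by move=> z _; rewrite lee_fin.
  - exact: (mE mk).
  by rewrite integral_u integral_k VE.
pose prodrho (s : n.-tuple T) : R := (\prod_(i < n) rho (tnth s i))%R.
have mprodrho : measurable_fun setT prodrho.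
  exact: (@measurable_prodr_tnth _ _ _ _ (fun=> rho)).
(* The sum of the [v] is moved to the left so that both sides are sums of nonnegative terms. *)
have pointwise (s : n.-tuple T) :
    (1 + lam * wg s + \sum_(i < n) v (tnth s i) <=
     b + \sum_(i < n) uk (tnth s i) +
     prodrho s * F (map_tuple (observe g t) s))%R.
  set S := (\sum_(i < n) uk (tnth s i) - \sum_(i < n) v (tnth s i))%R.
  have -> : prodrho s = expR (- S).
    rewrite /prodrho /rho -expR_sum; congr expR.
    rewrite sumrN /S -sumrB; congr (- _)%R.
    by apply: eq_bigr => i _; rewrite loglikE.
  rewrite /F -/(wg s).
  (* The inequality [1 + y <= expR y] at two values of [y], averaged with weights [1 - wg s] and
     [wg s]: the linear sides average to [1 + lam * wg s - b - S]. *)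
  have E0 := expR_ge1Dx (- b - S).
  have E1 := expR_ge1Dx (lam - b - S).
  have -> : (expR (- S) * (expR (- b) * (1 + (expR lam - 1) * wg s)) =
      (1 - wg s) * expR (- b - S) + wg s * expR (lam - b - S))%R.
    rewrite !expRD; ring.
  have W0 : (0 <= wg s)%R by exact: w0.
  have W1 : (0 <= 1 - wg s)%R by rewrite subr_ge0; exact: w1.
  have := ler_wpM2l W0 E1; have := ler_wpM2l W1 E0.
  rewrite /S; lra.
have addE (f1 f2 : n.-tuple T -> R) (m1 m2 : R) :
    measurable_fun setT f1 -> measurable_fun setT f2 ->
    (forall s, 0 <= f1 s)%R -> (forall s, 0 <= f2 s)%R ->
    \int[Pn]_s (f1 s)%:E = m1%:E -> \int[Pn]_s (f2 s)%:E = m2%:E ->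
    \int[Pn]_s (f1 s + f2 s)%:E = (m1 + m2)%:E.
  move=> mf1 mf2 f10 f20 f1E f2E; under eq_integral do rewrite EFinD.
  rewrite ge0_integralD//; last 4 first.
  - by move=> s _; rewrite lee_fin.
  - exact/measurable_EFinP.
  - by move=> s _; rewrite lee_fin.
  - exact/measurable_EFinP.
  by rewrite f1E f2E.
have mlw : measurable_fun [set: n.-tuple T] (fun s => 1 + lam * wg s)%R.
  by apply: measurable_funD => //; exact: measurable_funM.
have lw0 s : (0 <= 1 + lam * wg s)%R by rewrite addr_ge0// mulr_ge0// w0.
have msv := @measurable_sumr_tnth _ T R n v mv.
have sv0 (s : n.-tuple T) : (0 <= \sum_(i < n) v (tnth s i))%R by exact: sumr_ge0.
have msu := @measurable_sumr_tnth _ T R n uk muk.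
have su0 (s : n.-tuple T) : (0 <= \sum_(i < n) uk (tnth s i))%R by exact: sumr_ge0.
have mbu : measurable_fun [set: n.-tuple T]
    (fun s => b + \sum_(i < n) uk (tnth s i))%R by exact: measurable_funD.
have bu0 (s : n.-tuple T) : (0 <= b + \sum_(i < n) uk (tnth s i))%R.
  exact: addr_ge0.
have mrF : measurable_fun [set: n.-tuple T]
    (fun s => prodrho s * F (map_tuple (observe g t) s))%R.
  by apply: measurable_funM => //; exact: (measurableT_comp mF (measurable_map_tuple mo)).
have rF0 s : (0 <= prodrho s * F (map_tuple (observe g t) s))%R.
  by rewrite mulr_ge0// prodr_ge0.
have LE : \int[Pn]_s (1 + lam * wg s + \sum_(i < n) v (tnth s i))%:E =
    (1 + lam * c + n%:R * V)%:E.
  apply: addE => //; first by apply: aff => // s; exact: w0.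
  by rewrite integral_tuple_prob_sum// VE.
have RE : \int[Pn]_s (b + \sum_(i < n) uk (tnth s i) +
      prodrho s * F (map_tuple (observe g t) s))%:E =
    (b + n%:R * (V + (2 * sigma ^+ 2)^-1) +
     expR (- b) * (1 + (expR lam - 1) * q))%:E.
  apply: addE => //.
  under eq_integral do rewrite -[X in (b + X)%:E]mul1r.
  rewrite -[X in (b + X)%R]mul1r; apply: aff => //.
  by rewrite integral_tuple_prob_sum// ukE.
have : (1 + lam * c + n%:R * V)%:E <= (b + n%:R * (V + (2 * sigma ^+ 2)^-1) +
     expR (- b) * (1 + (expR lam - 1) * q))%:E.
  rewrite -LE -RE; apply: ge0_le_integral => //.
  - by move=> s _; rewrite lee_fin addr_ge0.
  - by apply/measurable_EFinP; exact: measurable_funD.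
  - by apply/measurable_EFinP; exact: measurable_funD.
  - by move=> s _; rewrite lee_fin; exact: pointwise.
(* The finite term [n%:R * V] cancels. *)
rewrite lee_fin mulrDr; lra.
Qed.

End correct_decision_bound.

(** * The cosine features: distinctness and normalisation *)

Section trigonometric_features.
Variable R : realType.
Local Notation mu := (@lebesgue_measure R).

Lemma sin_natpi n : sin (n%:R * pi) = 0 :> R.
Proof.
by elim: n => [|n IHn]; rewrite ?mul0r ?sin0// -natr1 mulrDl mul1r sinDpi IHn oppr0.
Qed.

(** With [b <= a], take [z = 1 / a]: the arguments are then [pi] and [b * pi / a], both in
    [[0, pi]], where [cos] is injective. *)
Lemma cos_natpi_inj (a b : nat) : (0 < a)%N -> (0 < b)%N ->
  (forall z : R, cos (a%:R * pi * z) = cos (b%:R * pi * z)) -> a = b.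
Proof.
wlog ab : a b / (b <= a)%N => [hw a0 b0 h|a0 b0 h].
  have [ba|/ltnW ab] := leqP b a; first exact: hw.
  by apply/esym; apply: hw.
have a0R : 0 < a%:R :> R by rewrite ltr0n.
have := h a%:R^-1.
rewrite mulrAC divff ?gt_eqF// mul1r => /(@cos_inj R).
rewrite !in_itv/= pi_ge0 lexx/= mulr_ge0 ?mulr_ge0 ?pi_ge0 ?invr_ge0//=.
rewrite ler_pdivrMr// mulrC ler_wpM2l ?pi_ge0 ?ler_nat// => /(_ isT isT).
have pi0 : pi != 0 :> R by rewrite gt_eqF ?pi_gt0.
move=> E; apply/eqP; rewrite -(eqr_nat R); apply/eqP/(mulfI pi0).
by rewrite {1}E; field; rewrite gt_eqF.
Qed.

Lemma continuous_phi i : continuous (@phi R i).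
Proof.
move=> x; apply: cvgM; first exact: cvg_cst.
apply: (continuous_comp (f := fun z => i.+1%:R * pi * z)); last exact: continuous_cos.
by apply: cvgM; [exact: cvg_cst|exact: cvg_id].
Qed.

Lemma measurable_phi i : measurable_fun setT (@phi R i).
Proof. by apply: continuous_measurable_fun; exact: continuous_phi. Qed.

Lemma phi0 i : phi i 0 = Num.sqrt 2 :> R.
Proof. by rewrite /phi mulr0 cos0 mulr1. Qed.

Lemma integral_phi_sqr i :
  (\int[uniformN11 R]_x (phi i x ^+ 2)%:E = 1)%E.
Proof.
rewrite integral_uniformN11; last 2 first.
- by apply/measurable_EFinP; apply: measurable_funX; exact: measurable_phi.
- by move=> x; rewrite lee_fin sqr_ge0.
pose a : R := i.+1%:R * pi.
have a0 : a != 0 by rewrite mulf_neq0// ?pnatr_eq0// gt_eqF ?pi_gt0.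
(* An antiderivative of [2 * cos (a * x) ^+ 2]. Its oscillating part vanishes at both endpoints
   because [a] is a multiple of [pi]. *)
pose F (x : R) : R := x + a^-1 * (sin (a * x) * cos (a * x)).
have dF (x : R) : is_derive x 1 F (phi i x ^+ 2).
  have dz : is_derive x (1 : R) (fun z : R => a * z) a.
    by apply: is_derive_eq; rewrite /GRing.scale/= mulr1.
  have ds := @is_derive1_comp R sin _ x _ _ (is_derive_sin (a * x)) dz.
  have dc := @is_derive1_comp R cos _ x _ _ (is_derive_cos (a * x)) dz.
  have dsc := is_deriveD (is_derive_id x (1 : R)) (is_deriveZ a^-1 (is_deriveM ds dc)).
  apply: (is_derive_eq dsc).
  rewrite /phi exprMn sqr_sqrtr// /GRing.scale/= -/a.
  have := cos2Dsin2 (a * x); set c := cos _; set s := sin _ => cs.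
  transitivity (1 + (c ^+ 2 - s ^+ 2)); first by field.
  by lra.
have cF : continuous F.
  move=> x; apply: differentiable_continuous; apply/derivable1_diffP.
  exact: (@ex_derive _ _ _ _ _ _ _ (dF x)).
rewrite (@continuous_FTC2 _ _ F)//.
- rewrite /F mulr1 mulrN1 sinN sin_natpi oppr0 !mul0r !mulr0 !addr0.
  by rewrite -EFinB -EFinM; congr (_%:E); lra.
- apply: continuous_subspaceT => x.
  by apply: cvgM; exact: continuous_phi.
- split; last 2 first.
  + apply: cvg_at_right_filter; exact: cF.
  + apply: cvg_at_left_filter; exact: cF.
  + by move=> x _; exact: (@ex_derive _ _ _ _ _ _ _ (dF x)).
- by move=> x _; rewrite derive1E (@derive_val _ _ _ _ _ _ _ (dF x)).
Qed.

End trigonometric_features.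

(** * The functions [gfun]: counting, injectivity and unit second moment *)

Section feature_products.
Variables (R : realType) (p q k : nat).
Implicit Types A B : {set 'I_q * 'I_p}.

Lemma validA_inj A : validA k A -> {in A &, injective (fun a => a.2)}.
Proof.
move=> /andP[_ /forall_inP vA] a b aA bA ab.
have /forall_inP/(_ b bA)/implyP := vA a aA.
by rewrite ab eqxx => /(_ isT)/eqP.
Qed.

(** Choose [k.+1] coordinates and a frequency for each: the graph of this choice is a valid index
    set, and distinct choices have distinct graphs. *)
Lemma card_validA :
  (q ^ k.+1 * 'C(p, k.+1) <= #|[pred A : {set 'I_q * 'I_p} | validA k A]|)%N.
Proof.
case: q => [|q']; first by rewrite exp0n.
(* The frequencies form a function on all of ['I_p] that is forced to be [ord0] off the chosen
   coordinates; otherwise [h] would not be injective on [X]. *)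
pose X := [set u : {set 'I_p} * {ffun 'I_p -> 'I_q'.+1} |
  (#|u.1| == k.+1) && (u.2 \in pffun_on ord0 u.1 predT)]%SET.
pose h (u : {set 'I_p} * {ffun 'I_p -> 'I_q'.+1}) := [set (u.2 j, j) | j in u.1]%SET.
have hE (u : {set 'I_p} * {ffun 'I_p -> 'I_q'.+1}) i j :
    ((i, j) \in h u) = (j \in u.1) && (i == u.2 j).
  apply/imsetP/andP => [[j' j'u [-> ->]]//|[ju /eqP ->]].
  by exists j.
have -> : (q'.+1 ^ k.+1 * 'C(p, k.+1))%N = #|X|.
  rewrite -sum1_card (eq_bigl (fun u : {set 'I_p} * {ffun 'I_p -> 'I_q'.+1} =>
    (#|u.1| == k.+1) && (u.2 \in pffun_on ord0 u.1 predT))); last first.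
    by move=> u; rewrite inE.
  rewrite -(pair_big_dep (fun S : {set 'I_p} => #|S| == k.+1)
    (fun S f => f \in pffun_on ord0 S predT) (fun _ _ => 1%N))/=.
  rewrite (eq_bigr (fun=> (q'.+1 ^ k.+1)%N)); last first.
    by move=> S /eqP Sk; rewrite sum1_card card_pffun_on card_ord Sk.
  rewrite sum_nat_const mulnC; congr (_ * _)%N.
  rewrite -[in LHS](card_ord p) -card_draws.
  by apply: eq_card => S; rewrite inE.
rewrite -(card_in_imset (f := h)).
  apply/subset_leq_card/fintype.subsetP => _ /imsetP[u uX ->].
  move: uX; rewrite !inE => /andP[/eqP uk _]; apply/andP; split.
    by rewrite (leq_trans (leq_imset_card _ _))// uk.
  apply/forall_inP => -[i j]; rewrite hE => /andP[_ /eqP ->].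
  apply/forall_inP => -[i' j']; rewrite hE => /andP[_ /eqP ->].
  by apply/implyP => /= /eqP ->.
move=> [S f] [S' f']; rewrite !inE/= => /andP[_ fS] /andP[_ fS'] hh.
have SS' : S = S'.
  apply/setP => j; apply/idP/idP => jS.
  - have : (f j, j) \in h (S, f) by rewrite hE jS eqxx.
    by rewrite hh hE => /andP[].
  - have : (f' j, j) \in h (S', f') by rewrite hE jS eqxx.
    by rewrite -hh hE => /andP[].
rewrite -{S'}SS' in fS' hh *; congr pair; apply/ffunP => j.
have [jS|jS] := boolP (j \in S).
  have : (f j, j) \in h (S, f) by rewrite hE jS eqxx.
  by rewrite hh hE => /andP[_ /eqP].
case/pffun_onP: fS => f0 _; case/pffun_onP: fS' => f'0 _.
by rewrite (supportP f0)// (supportP f'0).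
Qed.

Lemma measurable_gfun A : measurable_fun [set: p.-tuple R] (@gfun R q p A).
Proof.
rewrite /gfun; under eq_fun do rewrite big_mkcond/=.
apply: measurable_prod => a _; case: (_ \in _) => //.
exact: (measurableT_comp (@measurable_phi R a.1) (measurable_tnth a.2)).
Qed.

Definition axis_point (j : 'I_p) (z : R) : p.-tuple R :=
  [tuple if i == j then z else 0 | i < p].

(** Validity makes [(i, j)] the only pair of [A] at coordinate [j]; every other factor is evaluated
    at [0] and equals [Num.sqrt 2]. *)
Lemma gfun_axis_in A i j z : validA k A -> (i, j) \in A ->
  gfun A (axis_point j z) = Num.sqrt 2 ^+ #|A| * cos (i.+1%:R * pi * z).
Proof.
move=> vA ijA; rewrite /gfun (bigD1 (i, j))//= tnth_mktuple eqxx.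
rewrite (eq_bigr (fun=> Num.sqrt 2)); last first.
  move=> a /andP[aA aij]; rewrite tnth_mktuple.
  case: eqP => [aj|_]; last by rewrite phi0.
  by move: aij; rewrite (validA_inj vA aA ijA)// eqxx.
rewrite big_const (cardD1 (i, j) A) ijA add1n exprS iter_mulr_1 /phi.
rewrite mulrAC; congr (_ * _ ^+ _ * _); apply: eq_card => a.
by rewrite !inE andbC.
Qed.

Lemma gfun_axis_notin A j z : (forall i, (i, j) \notin A) ->
  gfun A (axis_point j z) = Num.sqrt 2 ^+ #|A|.
Proof.
move=> jA; rewrite /gfun (eq_bigr (fun=> Num.sqrt 2)).
  by rewrite prodr_const.
move=> [i j'] aA; rewrite tnth_mktuple/=; case: eqP => [jj|_]; last by rewrite phi0.
by have := jA i; rewrite -jj aA.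
Qed.

(** Compare the two functions along axis [j] for each [(i, j)] in the first set. If the second set
    has a pair at [j], the cosines agree and so do the frequencies; if not, the second function is
    constant on that axis while the first is not. *)
Lemma gfun_inj A B : validA k A -> validA k B -> @gfun R q p A = gfun B -> A = B.
Proof.
have sqrt2_neq0 m : Num.sqrt 2 ^+ m != 0 :> R.
  by rewrite expf_neq0// gt_eqF// sqrtr_gt0.
suff sub A' B' : validA k A' -> validA k B' -> @gfun R q p A' = gfun B' ->
    A' \subset B'.
  by move=> vA vB AB; apply/eqP; rewrite finset.eqEsubset !sub.
move=> vA vB AB; apply/fintype.subsetP => -[i j] ijA.
have h z : gfun B' (axis_point j z) = Num.sqrt 2 ^+ #|A'| * cos (i.+1%:R * pi * z).
  by rewrite -AB; exact: gfun_axis_in.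
have [[i' ijB]|noB] := pselect (exists i', (i', j) \in B').
  have h' (z : R) : Num.sqrt 2 ^+ #|B'| * cos (i'.+1%:R * pi * z) =
      Num.sqrt 2 ^+ #|A'| * cos (i.+1%:R * pi * z).
    by rewrite -h; exact/esym/gfun_axis_in.
  (* At [z = 0] both cosines are [1], so the powers of [Num.sqrt 2] are equal and can be
     cancelled. *)
  have := h' 0; rewrite !mulr0 cos0 !mulr1 => E.
  suff ii' : i'.+1 = i.+1 by case: ii' => /val_inj <-.
  apply: (@cos_natpi_inj R) => // z.
  by apply: (mulfI (sqrt2_neq0 #|B'|)); rewrite h' E.
have jB i' : (i', j) \notin B' by apply/negP => ijB; apply: noB; exists i'.
have h' (z : R) : Num.sqrt 2 ^+ #|B'| = Num.sqrt 2 ^+ #|A'| * cos (i.+1%:R * pi * z).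
  by rewrite -h gfun_axis_notin.
(* Between [z = 0] and [z = 1 / i.+1] the cosine goes from [1] to [-1], which a nonzero constant
   cannot follow. *)
have := h' 0; rewrite mulr0 cos0 mulr1 (h' i.+1%:R^-1).
rewrite mulrAC divff ?pnatr_eq0// mul1r cospi => /eqP.
by rewrite mulrN1 -subr_eq0 -opprD oppr_eq0 -mulr2n mulrn_eq0/= (negbTE (sqrt2_neq0 _)).
Qed.

Lemma integral_gfun_sqr A : validA k A ->
  (\int[tuple_prob (uniformN11 R) p]_x (gfun A x ^+ 2)%:E = 1)%E.
Proof.
move=> vA.
(* Groups the factors by coordinate. By validity each [h j] is a single squared feature or the empty
   product, of mean [1] in either case. *)
pose h (j : 'I_p) (z : R) := \prod_(a in A | a.2 == j) phi a.1 z ^+ 2.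
have mh j : measurable_fun setT (h j).
  rewrite /h; under eq_fun do rewrite big_mkcond/=.
  apply: measurable_prod => a _; case: (_ && _) => //.
  by apply: measurable_funX; exact: measurable_phi.
have h0 j z : 0 <= h j z by apply: prodr_ge0 => a _; exact: sqr_ge0.
rewrite -[RHS](@integral_tuple_prob_prod1 _ _ R (uniformN11 R) p h mh h0).
  apply: eq_integral => x _; congr (_%:E).
  rewrite /gfun -prodrXl (partition_big (fun a => a.2) predT)//=.
  by apply: eq_bigr => j _; apply: eq_bigr => a /andP[_ /eqP ->].
move=> j; have [[i ijA]|noA] := pselect (exists i, (i, j) \in A).
  rewrite -[RHS](integral_phi_sqr R i); apply: eq_integral => z _; congr (_%:E).
  rewrite /h (big_pred1 (i, j))// => a /=.
  apply/andP/eqP => [[aA /eqP aj]|->//=].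
  exact: (validA_inj vA aA ijA).
under eq_integral.
  move=> z _; rewrite /h big_pred0; last first.
    move=> [i j'] /=; apply/negP => /andP[aA /eqP jj].
    by apply: noA; exists i; rewrite -jj.
  over.
by rewrite integral_cst// [X in (_ * X)%E]probability_setT mule1.
Qed.

End feature_products.

(** * Means of functions with values in the unit interval *)

Section unit_interval_integrals.
Context d (T : measurableType d) (R : realType) (Q : probability T R).
Variable f : T -> R.
Hypotheses (mf : measurable_fun setT f) (f01 : forall x, 0 <= f x <= 1).
Local Open Scope ereal_scope.

Let f0 x : (0 <= f x)%R. Proof. by case/andP: (f01 x). Qed.
Let f1 x : (f x <= 1)%R. Proof. by case/andP: (f01 x). Qed.

Lemma integral_unit_fin_num : \int[Q]_x (f x)%:E \is a fin_num.
Proof.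
rewrite ge0_fin_numE; last by apply: integral_ge0 => x _; rewrite lee_fin.
apply: (@le_lt_trans _ _ (\int[Q]_x (cst 1 x))); last first.
  by rewrite integral_cst// [X in _ * X]probability_setT mule1 ltry.
apply: ge0_le_integral => //.
- by move=> x _; rewrite lee_fin.
- exact/measurable_EFinP.
- by move=> x _; rewrite lee_fin.
Qed.

Lemma integral_onem (c : R) : \int[Q]_x (f x)%:E = c%:E ->
  \int[Q]_x (1 - f x)%:E = (1 - c)%:E.
Proof.
move=> fc.
have : \int[Q]_x (1 - f x)%:E + \int[Q]_x (f x)%:E = 1.
  rewrite -ge0_integralD//.
  - under eq_integral do rewrite -EFinD subrK.
    by rewrite integral_cst// [X in _ * X]probability_setT mule1.
  - by move=> x _; rewrite lee_fin subr_ge0.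
  - by apply/measurable_EFinP; exact: measurable_funB.
  - by move=> x _; rewrite lee_fin.
  - exact/measurable_EFinP.
rewrite fc => E1; rewrite -[LHS](@addeK _ c%:E (\int[Q]_x (1 - f x)%:E))// E1 EFinB//.
Qed.

End unit_interval_integrals.

(** * Averaging the decision bound over all valid index sets *)

Theorem theorem2 (R : realType) (p q k : nat) (Y : set R) (t : R -> R)
  (sigma : R) (n : nat)
  (w : n.-tuple (p.-tuple R * R) -> {set 'I_q * 'I_p} -> R) :
  (0 < p)%N -> (0 < q)%N -> (0 < k)%N -> (k.+1 <= p)%N ->
  0 < sigma ->
  measurable_fun setT t -> (forall z, Y (t z)) ->
  (forall B, measurable_fun setT (fun s => w s B)) ->
  (forall s B, 0 <= w s B) ->
  (forall s B, ~~ validA k B -> w s B = 0) ->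
  (forall s, \sum_(B | validA k B) w s B = 1) ->
  n%:R <= (ln ((q ^ k.+1 * 'C(p, k.+1))%:R : R) - 2 * ln (2 : R)) * sigma ^+ 2 / 2 ->
  ((2 : R)^-1%:E <= err_prob k t sigma w)%E.
Proof.
move=> _ q0 _ kp sigma0 mt _ mw w0 _ w1 nle.
pose Q := tuple_prob (noisy_prob p sigma) n.
have mo (g : p.-tuple R -> R) : measurable_fun [set: p.-tuple R] g ->
    measurable_fun setT (fun s : n.-tuple (p.-tuple R * R) =>
      map_tuple (observe g t) s).
  by move=> mg; apply: measurable_map_tuple; exact: measurable_observe.
have mwo g A : measurable_fun [set: p.-tuple R] g ->
    measurable_fun setT (fun s => w (map_tuple (observe g t) s) A).
  by move=> mg; exact: (measurableT_comp (mw A) (mo g mg)).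
have w01 s A : validA k A -> 0 <= w s A <= 1.
  move=> vA; rewrite w0/= -(w1 s) (bigD1 A)//= lerDl.
  by apply: sumr_ge0 => B _; exact: w0.
pose prob g A := fine (\int[Q]_s (w (map_tuple (observe g t) s) A)%:E)%E.
have probE g A : measurable_fun [set: p.-tuple R] g -> validA k A ->
    (\int[Q]_s (w (map_tuple (observe g t) s) A)%:E = (prob g A)%:E)%E.
  move=> mg vA; rewrite fineK//; apply: integral_unit_fin_num; first exact: mwo.
  by move=> s; exact: w01.
(* [c A] is the probability of a correct answer when [gfun A] is true, [r A] that of answering [A]
   under pure noise. *)
pose c A := prob (gfun A) A.
pose r A := prob (fun=> 0) A.
have mgA A := @measurable_gfun R p q A.
have m0 : measurable_fun [set: p.-tuple R] (fun=> 0 : R) by exact: measurable_cst.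
(* One law, that of pure noise, serves for all [A], so the weights can be summed under the
   integral. *)
have sum_r : \sum_(A | validA k A) r A = 1.
  apply: EFin_inj; rewrite -sumEFin.
  transitivity (\sum_(A | validA k A)
      \int[Q]_s (w (map_tuple (observe (fun=> 0%R) t) s) A)%:E)%E.
    by apply: eq_bigr => A vA; rewrite probE.
  rewrite -big_filter -ge0_integral_sum//; last 2 first.
  - by move=> A; apply/measurable_EFinP; exact: mwo.
  - by move=> A s _; rewrite lee_fin w0.
  under eq_integral do rewrite big_filter sumEFin w1.
  exact: integral_tuple_prob_cst.
pose err (A : {set 'I_q * 'I_p}) s : R :=
  \sum_(B | validA k B) w s B * (if `[< @gfun R q p B = gfun A >] then 0 else 1).
(* By injectivity of [gfun], the only index set representing the true function is [A] itself. *)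
have errE A s : validA k A -> err A s = 1 - w s A.
  move=> vA; rewrite -(w1 s) /err (bigD1 A)//= [in RHS](bigD1 A)//=.
  rewrite asboolT// mulr0 add0r addrAC subrr add0r.
  apply: eq_bigr => B /andP[vB BA]; rewrite asboolF ?mulr1//.
  by move/(gfun_inj vB vA)/eqP; rewrite (negbTE BA).
have sampleEE A : validA k A ->
    sampleE (gfun A) t sigma (fun s => (err A s)%:E) = (1 - c A)%:E.
  move=> vA; rewrite (_ : (fun s => _) = (fun s => (1 - w s A)%:E)); last first.
    by apply/funext => s; rewrite errE.
  rewrite sampleE_integral//.
  - apply: (integral_onem (f := fun s => w (map_tuple (observe (gfun A) t) s) A)).
    + exact: mwo.
    + by move=> s; exact: w01.
    + exact: probE.
  - by apply/measurable_EFinP; exact: measurable_funB.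
  - by move=> s; rewrite lee_fin subr_ge0; case/andP: (w01 s _ vA).
rewrite /err_prob (eq_bigr (fun A => (1 - c A)%:E)); last first.
  by move=> A vA; exact: sampleEE.
rewrite sumEFin -EFinM lee_fin sumrB sumr_const.
have -> : #|[set A : {set 'I_q * 'I_p} | validA k A]| =
    #|[pred A : {set 'I_q * 'I_p} | validA k A]|.
  by apply: eq_card => A; apply/idP/idP; rewrite !inE.
set N := #|_|; pose NR : R := N%:R.
have M0 : (0 < q ^ k.+1 * 'C(p, k.+1))%N by rewrite muln_gt0 expn_gt0 q0 bin_gt0.
have MN : (q ^ k.+1 * 'C(p, k.+1) <= N)%N := card_validA p q k.
have N0 : 0 < NR by rewrite ltr0n (leq_trans M0).
have lnMN : ln ((q ^ k.+1 * 'C(p, k.+1))%:R : R) <= ln NR.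
  by rewrite ler_ln ?posrE /NR ?ltr0n ?ler_nat// (leq_trans M0).
have ln2 : 0 < ln (2 : R) by rewrite ln_gt0// ltr1n.
have s2 : 0 < sigma ^+ 2 by exact: exprn_gt0.
move: nle lnMN; set L := ln _%:R => nle LN.
pose K := n%:R / (2 * sigma ^+ 2).
have K0 : 0 <= K by rewrite divr_ge0// mulr_ge0// ltW.
(* The hypothesis on [n], divided by [2 * sigma ^+ 2]. Together with [K0] it also forces
   [2 * ln 2 <= L]. *)
have KL : K <= (L - 2 * ln 2) / 4.
  rewrite ler_pdivrMr ?mulr_gt0//; apply: (le_trans nle).
  by rewrite le_eqVlt; apply/orP; left; apply/eqP; field.
have lnN0 : 0 < ln NR by lra.
have bound A : validA k A ->
    1 + ln NR * c A <= ln 2 + K + 2^-1 * (1 + (NR - 1) * r A).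
  move=> vA.
  have := @correct_decision_bound R sigma p (gfun A) t sigma0 (mgA A) mt
    (integral_gfun_sqr R vA) n (fun s => w s A) (ln NR) (ln 2) (c A) (r A) (mw A).
  rewrite expRN !lnK ?posrE//; apply => //.
  - by move=> s; exact: w01.
  - exact: ltW.
  - exact: ltW.
  - exact: probE.
  - exact: probE.
set C := \sum_(A | _) _.
(* The bounds are summed with the [r A] adding up to [1]. The choice [b = ln 2] makes the last term
   [NR - 1 / 2], which the [NR] on the left absorbs. *)
have H : NR + ln NR * C <= NR * (ln 2 + K) + 2^-1 * (NR + (NR - 1)).
  have sumN (x : R) : \sum_(A : {set 'I_q * 'I_p} | validA k A) x = NR * x.
    by rewrite sumr_const mulr_natl.
  have -> : NR + ln NR * C = \sum_(A | validA k A) (1 + ln NR * c A).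
    by rewrite big_split/= sumN mulr1 mulr_sumr.
  have -> : NR * (ln 2 + K) + 2^-1 * (NR + (NR - 1)) =
      \sum_(A | validA k A) (ln 2 + K + 2^-1 * (1 + (NR - 1) * r A)).
    rewrite big_split/= sumN; congr (_ + _).
    rewrite -mulr_sumr big_split/= sumN mulr1 -[in RHS]mulr_sumr sum_r.
    by rewrite mulr1.
  by apply: ler_sum => A; exact: bound.
have CN : C <= NR / 2.
  rewrite -(ler_pM2l lnN0).
  (* Indeed [ln 2 + K <= L / 4 + ln 2 / 2], which is at most [L / 2] because [2 * ln 2 <= L]. *)
  have : NR * (ln 2 + K) <= NR * (ln NR / 2) by rewrite ler_pM2l//; lra.
  lra.
rewrite -(ler_pM2l N0) -/NR mulVKf ?gt_eqF//; lra.
Qed.
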